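(* Let $T$ be a finite non-abelian simple group, and consider primitive groups $G\le D(2,T)$ of simple diagonal type. (1) If $G=T^2$, then $\mathrm{orbdiam}(G)=c_i(T)$. (2) If $G=D(2,T)$, then $\mathrm{orbdiam}(G)=c_A(T)$.
   Context: Simple diagonal groups (with $k=2$). $T$ is identified with $\mathrm{Inn}(T)\le\mathrm{Aut}(T)$. $D(2,T)=\{(\tau_1,\tau_2).\pi : \tau_i\in \mathrm{Aut}(T),\ \pi\in S_2,\ \tau_1,\tau_2 \text{ lie in the same } \mathrm{Inn}(T)\text{-coset}\}\cong T^2.(\mathrm{Out}(T)\times S_2)$. For $T^2\le G\le D(2,T)$ let $D_A=G\cap\{(\alpha,\alpha).\pi:\alpha\in \mathrm{Aut}(T),\pi\in S_2\}$; $G$ acts by right multiplication on the set $\Omega=(G:D_A)$ of right cosets of $D_A$ in $G$. Orbital diameter. For a primitive permutation group $G$ on a finite set $\Omega$, an orbital is an orbit of $G$ on $\Omega\times\Omega$; for each non-diagonal orbital $\Gamma$ the corresponding orbital graph is the undirected graph with vertex set $\Omega$ and edges $\{\alpha,\beta\}$ for $(\alpha,\beta)\in\Gamma$. $\mathrm{orbdiam}(G)$ is the supremum of the diameters of the orbital graphs of $G$. Widths. For a generating set $S$ of $T$, $w_S(T)$ is the minimal $m\in\mathbb N$ such that every element of $T$ is a product of at most $m$ elements of $S$. $c_i(T)=\max_{t\in T\setminus\{1\}} w_{C}(T)$ with $C=t^T\cup(t^{-1})^T$, and $c_A(T)=\max_{t\in T\setminus\{1\}} w_{C}(T)$ with $C=\{(t^{\alpha})^{\pm1}:\alpha\in\mathrm{Aut}(T)\}$.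 *)

(* Defs.v *)
From HB Require Import structures.
From mathcomp Require Import all_boot all_order all_algebra all_fingroup.
From mathcomp Require Import all_solvable.
From mathcomp Require Import boolp constructive_ereal.

Set Implicit Arguments.
Unset Strict Implicit.
Unset Printing Implicit Defensive.

Import Order.TTheory GRing.Theory Num.Theory.

Local Open Scope group_scope.

(* Extended natural numbers are taken in [\bar int]; the infimum of the empty
   set is [+oo], so a disconnected graph has diameter [+oo] and a set that does
   not generate has width [+oo]. *)
Definition inf_nat (P : nat -> Prop) : \bar int :=
  if pselect (exists n, `[< P n >]) is left exP then ((ex_minn exP)%:Z)%:E
  else +oo%E.

Section OrbitalDiameter.

Variables (aT : finGroupType) (rT : finType).

(* [path e x p] is a walk from [x] to [last x p] with [size p] edges. *)
Definition dist (e : rel rT) (x y : rT) : \bar int :=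
  inf_nat (fun n => exists p, [/\ path e x p, last x p = y & size p = n]).

Definition diam (V : {set rT}) (e : rel rT) : \bar int :=
  \big[maxe/0%E]_(x in V) \big[maxe/0%E]_(y in V) dist e x y.

Variables (G : {set aT}) (Omega : {set rT}) (to : {action aT &-> rT}).

Definition orbital (a b : rT) : {set rT * rT} :=
  [set (to a g, to b g) | g in G].

Definition nondiag_orbitals : {set {set rT * rT}} :=
  [set orbital a b | a in Omega, b in Omega & a != b].

Definition orbital_graph (Gamma : {set rT * rT}) : rel rT :=
  fun a b => ((a, b) \in Gamma) || ((b, a) \in Gamma).

Definition orbdiam : \bar int :=
  \big[maxe/0%E]_(Gamma in nondiag_orbitals) diam Omega (orbital_graph Gamma).

End OrbitalDiameter.

Arguments orbdiam {aT rT} G%_g Omega%_g to%_act.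

Section Widths.

Variables (gT : finGroupType) (T : {set gT}).

Definition width (S : {set gT}) : \bar int :=
  inf_nat (fun m => forall x, x \in T ->
    exists s : seq gT,
      [/\ (size s <= m)%N, {subset s <= S} & x = \prod_(y <- s) y]).

Definition c_i : \bar int :=
  \big[maxe/0%E]_(t in T^#) width (t ^: T :|: t^-1 ^: T).

Definition c_A : \bar int :=
  \big[maxe/0%E]_(t in T^#)
    width ([set (a : {perm gT}) t | a in Aut T]
           :|: [set ((a : {perm gT}) t)^-1 | a in Aut T]).

End Widths.

Section Wreath.

Variable gT : finGroupType.

(* The nontrivial element of ['S_2] is the odd one. *)
Definition swap_act (u : gT * gT) (p : 'S_2) : gT * gT :=
  if odd_perm p then (u.2, u.1) else u.

Lemma swap_act1 u : swap_act u 1 = u.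
Proof. by rewrite /swap_act odd_perm1. Qed.

Lemma swap_actM u p q : swap_act u (p * q) = swap_act (swap_act u p) q.
Proof.
by rewrite /swap_act odd_permM; case: u => x y; case: odd_perm; case: odd_perm.
Qed.

Canonical swap_action := TotalAction swap_act1 swap_actM.

Lemma swap_is_groupAction : is_groupAction [set: gT * gT] swap_action.
Proof.
move=> p _; rewrite /= inE; apply/andP; split.
  by apply/subsetP=> u _; rewrite inE.
apply/morphicP=> -[x1 x2] [y1 y2] _ _; rewrite !actpermE /= /swap_act.
by case: odd_perm.
Qed.

Canonical swap_groupAction := GroupAction swap_is_groupAction.

Definition wreath2 : finGroupType := sdprod_by swap_groupAction.

(* The element written $(x_1, x_2).\pi$. *)
Definition wr (u : gT * gT) (p : 'S_2) : wreath2 :=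
  sdpair1 swap_groupAction u * sdpair2 swap_groupAction p.

Lemma wr_pair u p : val (wr u p) = (p, swap_act u p).
Proof.
have -> : val (wr u p) = ((1 * p)%g, (swap_act u p * 1)%g).
  rewrite /wr /sdpair1 /sdpair2 /=.
  by rewrite !val_insubd !inE.
by rewrite mul1g mulg1.
Qed.

Lemma wrM u v p q : wr u p * wr v q = wr (u * swap_act v p) (p * q).
Proof.
apply: val_inj; rewrite wr_pair.
have -> : val (wr u p * wr v q) =
    (((val (wr u p)).1 * (val (wr v q)).1)%g,
     (swap_act (val (wr u p)).2 (val (wr v q)).1 * (val (wr v q)).2)%g) by [].
rewrite !wr_pair /=; congr pair.
case: u v => [x y] [z t]; rewrite /swap_act !odd_permM.
by case: odd_perm; case: odd_perm.
Qed.

Lemma wr1 : wr 1 1 = 1.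
Proof. by rewrite /wr !morph1 mulg1. Qed.

End Wreath.

Section Diagonal.

Variables (gT : finGroupType) (T : {group gT}).

Definition Inn : {set {perm gT}} := conj_aut T @* T.
Canonical Inn_group := [group of Inn].

Definition T2 : {set wreath2 {perm gT}} :=
  sdpair1 (swap_groupAction {perm gT}) @* setX Inn Inn.
Canonical T2_group := [group of T2].

Definition D2 : {set wreath2 {perm gT}} :=
  [set wr t p | t in [set t : {perm gT} * {perm gT} |
    [&& t.1 \in Aut T, t.2 \in Aut T & Inn :* t.1 == Inn :* t.2]], p in [set: 'S_2]].

Definition full_diag : {set wreath2 {perm gT}} :=
  [set wr (a, a) p | a in Aut T, p in [set: 'S_2]].

Definition D_A (G : {set wreath2 {perm gT}}) : {set wreath2 {perm gT}} :=
  G :&: full_diag.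

Lemma Inn_normal : Inn <| Aut T.
Proof.
apply/andP; split.
  by apply/subsetP=> _ /morphimP[x _ _ ->]; rewrite Aut_aut.
apply/normsP=> a Aa; apply/eqP; rewrite eqEcard cardJg leqnn andbT.
apply/subsetP=> _ /imsetP[_ /morphimP[x Nx Tx ->] ->].
have aT y : y \in T -> a y \in T by move=> Ty; rewrite Aut_closed.
suff -> : conj_aut T x ^ a = conj_aut T (a x).
  by apply: mem_morphim; [rewrite (subsetP (normG T)) ?aT | apply: aT].
have Ac : conj_aut T x \in Aut T by rewrite Aut_aut.
apply: (@eq_Aut _ T); rewrite ?Aut_aut ?groupJ // => y Ty.
rewrite conj_autE ?aT // /conjg !permM.
have Tz : a^-1 y \in T by rewrite (@Aut_closed _ T) ?groupV.
rewrite conj_autE // -!/(conjg _ _).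
have fa := autmE Aa; rewrite -fa morphJ //= !fa.
by rewrite permKV.
Qed.

Lemma D2_group_set : group_set D2.
Proof.
apply/group_setP; split.
  apply/imset2P; exists (1, 1) 1; rewrite ?in_setT //; last by rewrite -wr1.
  by rewrite in_set /= !group1 eqxx.
move=> _ _ /imset2P[[x1 x2] p Dx _ ->] /imset2P[[y1 y2] q Dy _ ->].
move: Dx Dy; rewrite in_set /= => /and3P[Ax1 Ax2 /eqP eqx].
rewrite in_set /= => /and3P[Ay1 Ay2 /eqP eqy].
have nIA a : a \in Aut T -> a \in 'N(Inn).
  by apply/subsetP; case/andP: Inn_normal.
have Inn_mul a b : a \in Aut T -> b \in Aut T ->
    Inn :* (a * b) = (Inn :* a) * (Inn :* b).
  by move=> Aa Ab; rewrite rcoset_mul ?nIA.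
rewrite wrM; set w := _ * swap_act _ _.
apply/imset2P; exists w (p * q) => //.
rewrite in_set /w /swap_act; case: odd_perm => /=.
all: rewrite !groupM //=; apply/eqP.
all: by rewrite !Inn_mul // eqx eqy.
Qed.
Canonical D2_group := Group D2_group_set.

Lemma full_diag_group_set : group_set full_diag.
Proof.
apply/group_setP; split.
  by apply/imset2P; exists 1 1; rewrite ?group1 // (wr1 _).
move=> _ _ /imset2P[x p Ax _ ->] /imset2P[y q Ay _ ->].
apply/imset2P; exists (x * y) (p * q); rewrite ?in_setT ?groupM // wrM.
by congr wr; rewrite /swap_act; case: odd_perm.
Qed.
Canonical full_diag_group := Group full_diag_group_set.

End Diagonal.

Canonical D_A_group (gT : finGroupType) (T : {group gT})
  (G : {group wreath2 {perm gT}}) := [group of D_A T G].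

Definition Omega (gT : finGroupType) (T : {group gT})
    (G : {set wreath2 {perm gT}}) : {set {set wreath2 {perm gT}}} :=
  rcosets (D_A T G) G.

(* Main.v *)
Require Import Defs.
From mathcomp Require Import all_boot all_order all_algebra all_fingroup.
From mathcomp Require Import all_solvable.
From mathcomp Require Import boolp constructive_ereal.

Set Implicit Arguments.
Unset Strict Implicit.
Unset Printing Implicit Defensive.

Import Order.TTheory GRing.Theory Num.Theory.

Local Open Scope group_scope.

(** The vertices of the coset graph can be named by the elements of T. Since T^2
    is contained in G and G in D(2,T), every coset of D_A in G contains some
    (1, i_t^-1), where i_t is conjugation by t; as Z(T) = 1, the element t is
    unique. So t |-> D_A (1, i_t^-1) is a bijection from T onto Omega
    ([Omega_points], [point_inj]). The inverse in this parametrisation makes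
    (1, i_s) act on T as the left translation by s^-1, while an element
    (a, a).p of D_A sends t to a(t), or to a(t)^-1 when p is the swap
    ([point_translate], [point_diag]).

    By transitivity of the translations every orbital is that of a pair (1, t)
    of labels. The neighbours of 1 in its graph are then the a(t)^(+-1), where a
    runs over the group A of all a such that (a, a).p lies in G for
    some p: this is the suborbit of t under the stabiliser D_A of 1, closed
    under inversion because the graph is undirected. Left translations being
    automorphisms of the graph, it is the Cayley graph of T with connection set
    {a(t)^(+-1) : a in A} ([orbital_graph_point]). Distances in a Cayley graph
    are lengths of shortest words, so its diameter is the width of T with
    respect to the connection set ([diam_cayley]); this includes the case where
    both are infinite. Therefore, for every T^2 <= G <= D(2,T),
    orbdiam(G) is the maximum over t <> 1 of these widths
    ([orbdiam_diagonal]). Finally A = Inn(T) when G = T^2, which gives c_i(T),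
    and A = Aut(T) when G = D(2,T), which gives c_A(T). *)

(** * Extended natural numbers *)

Lemma inf_natP (P : nat -> Prop) (n : nat) :
  (inf_nat P <= (n%:Z)%:E)%E <-> exists2 m, (m <= n)%N & P m.
Proof.
rewrite /inf_nat; case: pselect => [exP|nexP].
  case: ex_minnP => m /asboolP Pm minm; rewrite lee_fin lez_nat.
  split=> [lemn|[k lekn Pk]]; first by exists m.
  by apply: leq_trans lekn; apply/minm/asboolP.
split=> [|[m _ Pm]]; first by [].
by case: nexP; exists m; apply/asboolP.
Qed.

Lemma inf_nat_ge0 (P : nat -> Prop) : (0 <= inf_nat P)%E.
Proof.
by rewrite /inf_nat; case: pselect => [exP|_]; rewrite ?lee_fin ?lez_nat ?leey.
Qed.

(** Both widths and diameters are only known through their natural upper bounds;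
    for nonnegative values in [\bar int] these determine the order, because such
    a value is either a natural number or infinite. *)
Lemma le_from_nat_bounds (u v : \bar int) : (0 <= v)%E ->
  (forall n : nat, (v <= (n%:Z)%:E)%E -> (u <= (n%:Z)%:E)%E) -> (u <= v)%E.
Proof.
case: v => [[n|n]| |] //=.
  by move=> _ uv; apply: (uv n).
by move=> _ _; rewrite leey.
Qed.

Lemma eq_from_nat_bounds (u v : \bar int) : (0 <= u)%E -> (0 <= v)%E ->
  (forall n : nat, (u <= (n%:Z)%:E)%E <-> (v <= (n%:Z)%:E)%E) -> u = v.
Proof.
move=> u0 v0 uv; apply/eqP; rewrite eq_le.
by apply/andP; split; apply: le_from_nat_bounds => // n; case: (uv n).
Qed.

Lemma nat_ereal_ge0 (n : nat) : (0 <= (n%:Z)%:E :> \bar int)%E.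
Proof. by rewrite lee_fin lez_nat. Qed.

Lemma bigmaxe_ge0 (I : finType) (P : pred I) (F : I -> \bar int) :
  (0 <= \big[maxe/0%E]_(i | P i) F i)%E.
Proof. exact: bigmax_ge_id. Qed.

(** * The diameter of a Cayley graph *)

Section CayleyDiameter.

Variables (gT : finGroupType) (rT : finType) (T : {group gT}) (S : {set gT}).
Variables (pt : gT -> rT) (e : rel rT).
Hypotheses (sST : S \subset T) (pt_inj : {in T &, injective pt}).
Hypothesis e_closed : forall a b, e a b -> b \in pt @: T.
Hypothesis e_pt : {in T &, forall a b, e (pt a) (pt b) = (a^-1 * b \in S)}.

(** The labels of the successive steps of a walk from [a] to [b] multiply to
    [a^-1 * b]. The hypothesis [e_closed] keeps walks inside the copy of [T],
    since [rT] may have further vertices. *)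
Lemma cayley_walkP a b n : a \in T -> b \in T ->
  (exists p, [/\ path e (pt a) p, last (pt a) p = pt b & size p = n]) <->
  (exists w : seq gT,
     [/\ size w = n, {subset w <= S} & a^-1 * b = \prod_(y <- w) y]).
Proof.
elim: n a => [|n IHn] a Ta Tb; split.
- case=> p [_ + /size0nil p0]; rewrite {}p0 /= => /(pt_inj Ta Tb) <-.
  by exists [::]; split=> //; rewrite big_nil mulVg.
- case=> w [/size0nil-> _]; rewrite big_nil => ab.
  exists [::]; split=> //=; congr pt.
  by rewrite -(mulg1 a) -ab mulKVg.
- case=> -[|x p] [] //= /andP[eax pp] lastp [szp].
  have /imsetP[c Tc xc] := e_closed eax; rewrite {x}xc in eax pp lastp.
  have [|w [szw sw cb]] := (IHn c Tc Tb).1; first by exists p.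
  exists (a^-1 * c :: w); split=> /=; first by rewrite szw.
    move=> y; rewrite inE => /predU1P[->|/sw//].
    by rewrite -e_pt.
  by rewrite big_cons -cb mulgA mulgK.
case=> -[|s w] [] //= [szw] sw; rewrite big_cons => ab.
have Ss : s \in S by apply: sw; rewrite inE eqxx.
have Tas : a * s \in T by rewrite groupM // (subsetP sST).
have [|p [pp lastp szp]] := (IHn (a * s) Tas Tb).2.
  exists w; split=> // [y wy|]; first by apply: sw; rewrite inE wy orbT.
  by rewrite invMg -mulgA ab mulKg.
exists (pt (a * s) :: p); split=> /=; last by rewrite szp.
  by rewrite e_pt // mulKg Ss.
by [].
Qed.

Lemma diam_cayley : diam (pt @: T) e = width T S.
Proof.
apply: eq_from_nat_bounds => [||n]; [exact: bigmaxe_ge0|exact: inf_nat_ge0|].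
split=> [diamn|/inf_natP[m lemn wm]].
  apply/inf_natP; exists n => // x Tx.
  have Vt t : t \in T -> pt t \in pt @: T by apply: imset_f.
  have : (dist e (pt 1) (pt x) <= (n%:Z)%:E)%E.
    apply: le_trans diamn; apply: bigmax_sup (Vt 1 (group1 T)) _.
    by apply: bigmax_sup (Vt x Tx) _.
  case/inf_natP=> m lemn /(cayley_walkP _ (group1 T) Tx)[w [szw sw xw]].
  by exists w; split; rewrite ?szw // -xw invg1 mul1g.
apply/bigmax_leP; split=> [|_ /imsetP[a Ta ->]]; first exact: nat_ereal_ge0.
apply/bigmax_leP; split=> [|_ /imsetP[b Tb ->]]; first exact: nat_ereal_ge0.
have [w [szw sw abw]] := wm _ (groupM (groupVr Ta) Tb).
apply/inf_natP; exists (size w); first exact: leq_trans szw lemn.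
by apply/cayley_walkP => //; exists w.
Qed.

End CayleyDiameter.

(** * Conjugations and elements of the wreath product *)

Lemma center_simple_nonabelian (gT : finGroupType) (T : {group gT}) :
  simple T -> ~~ abelian T -> 'Z(T) = 1.
Proof.
case/simpleP=> _ simT /negP nabT.
have [//|ZT] := simT _ (center_normal T).
by case: nabT; apply/center_idP.
Qed.

Lemma conj_autJ (gT : finGroupType) (T : {group gT}) (a : {perm gT}) t :
  a \in Aut T -> t \in T -> conj_aut T t ^ a = conj_aut T (a t).
Proof.
move=> Aa Tt; have aT y : y \in T -> a y \in T by move=> Ty; rewrite Aut_closed.
apply: (@eq_Aut _ T); rewrite ?groupJ ?Aut_aut // => y Ty.
rewrite conj_autE ?aT // /conjg !permM.
have Tz : a^-1 y \in T by rewrite (@Aut_closed _ T) ?groupV.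
rewrite conj_autE // -/(conjg _ _) -(autmE Aa) morphJ //= !autmE.
by rewrite permKV.
Qed.

Lemma wr_inj (gT : finGroupType) (u v : gT * gT) p q :
  wr u p = wr v q -> u = v /\ p = q.
Proof.
move/(congr1 val); rewrite !wr_pair => -[<-].
by case: u v => [x y] [z t]; rewrite /swap_act; case: odd_perm => -[-> ->].
Qed.

(** The connection set of the Cayley graph attached to [t]: with A = Inn(T) it
    is t^T together with its inverses, with A = Aut(T) the set in c_A(T). *)
Definition signed_images (gT : finGroupType) (A : {set {perm gT}}) (t : gT)
    : {set gT} :=
  [set (a : {perm gT}) t | a in A] :|: [set ((a : {perm gT}) t)^-1 | a in A].

Lemma signed_imagesV (gT : finGroupType) (A : {set {perm gT}}) (t u : gT) :
  (u^-1 \in signed_images A t) = (u \in signed_images A t).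
Proof.
suff sub v : v \in signed_images A t -> v^-1 \in signed_images A t.
  by apply/idP/idP=> /sub; rewrite ?invgK.
case/setUP=> /imsetP[a Aa ->]; rewrite ?invgK; apply/setUP; [right|left].
  by apply/imsetP; exists a.
by apply/imsetP; exists a.
Qed.

(** * The action on the cosets of the diagonal *)

Section DiagonalAction.

Variables (gT : finGroupType) (T : {group gT}) (G : {group wreath2 {perm gT}}).
Hypotheses (ZT : 'Z(T) = 1) (sT2G : T2 T \subset G) (sGD2 : G \subset D2 T).

Local Notation inn := (conj_aut T).
Local Notation D := (D_A T G).

(** The automorphisms induced on T by the point stabiliser [D], when signs are
    forgotten: the swap acts on labels as inversion. *)
Definition diag_proj : {set {perm gT}} :=
  [set a in Aut T | [exists p, wr (a, a) p \in G]].

(** The inverse turns the second factor of T^2 into left translations of the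
    labels, so that the quantity preserved by it is [a^-1 * b]. *)
Definition point (t : gT) : {set wreath2 {perm gT}} :=
  D :* wr (1, inn t^-1) 1.

Lemma innM s t : s \in T -> t \in T -> inn (s * t) = inn s * inn t.
Proof. by move=> Ts Tt; rewrite morphM // (subsetP (normG T)). Qed.

Lemma innV t : t \in T -> inn t^-1 = (inn t)^-1.
Proof. by move=> Tt; rewrite morphV // (subsetP (normG T)). Qed.

(** The kernel of the conjugation action of T on itself is Z(T). *)
Lemma inn_inj : {in T &, injective inn}.
Proof.
move=> s t Ts Tt eqst; apply/eqP; rewrite eq_mulgV1 -in_set1.
have nT := subsetP (normG T).
suff: s * t^-1 \in 'Z(T) by rewrite ZT.
rewrite inE groupM ?groupV //= -(ker_conj_aut T).
apply/kerP; rewrite ?nT ?groupM ?groupV //=.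
by rewrite innM ?groupV // innV // eqst mulgV.
Qed.

Lemma mem_Inn t : t \in T -> inn t \in Inn T.
Proof. by move=> Tt; rewrite mem_morphim // (subsetP (normG T)). Qed.

Lemma InnP x : reflect (exists2 t, t \in T & x = inn t) (x \in Inn T).
Proof.
apply: (iffP morphimP) => [[t _ Tt ->]|[t Tt ->]]; first by exists t.
by exists t; rewrite // (subsetP (normG T)).
Qed.

Lemma wr_sdpair1 (u : {perm gT} * {perm gT}) :
  wr u 1 = sdpair1 (swap_groupAction {perm gT}) u.
Proof. by rewrite /wr morph1 mulg1. Qed.

Lemma mem_T2 x y : x \in Inn T -> y \in Inn T -> wr (x, y) 1 \in T2 T.
Proof.
move=> Ix Iy; rewrite wr_sdpair1.
by apply: mem_morphim; rewrite ?inE //= Ix.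
Qed.

Lemma T2P g : reflect (exists2 u, u \in setX (Inn T) (Inn T) & g = wr u 1)
  (g \in T2 T).
Proof.
apply: (iffP morphimP) => [[u _ Iu ->]|[u Iu ->]].
  by exists u; rewrite ?wr_sdpair1.
by exists u; rewrite ?in_setT ?wr_sdpair1.
Qed.

Lemma T2_in_G s t : s \in T -> t \in T -> wr (inn s, inn t) 1 \in G.
Proof. by move=> Ts Tt; rewrite (subsetP sT2G) // mem_T2 ?mem_Inn. Qed.

Lemma T2_in_G1 t : t \in T -> wr (1, inn t) 1 \in G.
Proof. by move=> Tt; rewrite -(morph1 (conj_aut_morphism T)) T2_in_G. Qed.

Lemma mem_D a p : (wr (a, a) p \in D) = (a \in Aut T) && (wr (a, a) p \in G).
Proof.
rewrite inE andbC; apply: andb_id2r => _; apply/imset2P/idP => [[b q Ab _]|Aa].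
  by case/wr_inj=> -[-> _] _.
by exists a p.
Qed.

Lemma DP g : g \in D -> exists2 a, a \in Aut T & exists p, g = wr (a, a) p.
Proof. by case/setIP=> _ /imset2P[a p Aa _ ->]; exists a => //; exists p. Qed.

Lemma mem_D_inn t : t \in T -> wr (inn t, inn t) 1 \in D.
Proof. by move=> Tt; rewrite mem_D T2_in_G // Aut_aut. Qed.

Lemma diag_projP a :
  reflect (exists p, wr (a, a) p \in D) (a \in diag_proj).
Proof.
rewrite inE; apply: (iffP andP) => [[Aa /existsP[p Gp]]|[p]].
  by exists p; rewrite mem_D Aa.
by rewrite mem_D => /andP[Aa Gp]; split=> //; apply/existsP; exists p.
Qed.

Lemma point_translate s t : s \in T -> t \in T ->
  point t :* wr (1, inn s) 1 = point (s^-1 * t).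
Proof.
move=> Ts Tt; rewrite /point -rcosetM wrM /= /swap_act odd_perm1 mulg1 invMg.
by rewrite invgK innM ?groupV //= -[in RHS](mulg1 1).
Qed.

(** Right multiplication of [D g] by an element d of [D] amounts to conjugating
    the representative g by d, here (1, i_t^-1) by (a, a).p. If p is even this
    is (1, i_(a t)^-1); if p is odd it is (i_(a t)^-1, 1), which a diagonal factor
    brings back to (1, i_(a t)). *)
Lemma point_diag a p t : wr (a, a) p \in D -> t \in T ->
  point t :* wr (a, a) p = point (if odd_perm p then (a t)^-1 else a t).
Proof.
move=> Dap Tt; have Aa: a \in Aut T by move: Dap; rewrite mem_D => /andP[].
have Tat : a t \in T by rewrite Aut_closed.
rewrite /point -rcosetM; apply/rcoset_eqP.
have inn_aV : inn t^-1 * a = a * inn (a t)^-1.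
  by rewrite innV // [inn (a t)^-1]innV // -conj_autJ // -conjVg -conjgC.
case: ifP => odd_p; apply/rcosetP.
  (* The factor (i_t^-1, i_t^-1) is the diagonal correction that moves the
     nontrivial component back to the second coordinate. *)
  exists (wr (inn t^-1, inn t^-1) 1 * wr (a, a) p).
    by rewrite groupM // mem_D_inn // groupV.
  rewrite !wrM !mul1g !mulg1 /swap_act odd_perm1 odd_p invgK /=.
  congr wr; congr pair; rewrite /= ?mulg1 // inn_aV.
  by rewrite innV // mulgKV mul1g.
exists (wr (a, a) p) => //.
rewrite !wrM /swap_act odd_perm1 odd_p /= !mulg1 !mul1g.
by congr wr; congr pair; rewrite /= ?mulg1 ?mul1g ?inn_aV.
Qed.

Lemma point_inj : {in T &, injective point}.
Proof.
move=> s t Ts Tt /rcoset_eqP/rcosetP[_ /DP[a Aa [p ->]]].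
rewrite wrM => /wr_inj[+ p1]; rewrite mulg1 in p1.
rewrite -p1 /swap_act odd_perm1 => -[]; rewrite mulg1 => <-; rewrite mul1g.
by move/inn_inj/invg_inj; apply; rewrite ?groupV.
Qed.

Lemma point1 : point 1 = D.
Proof. by rewrite /point invg1 morph1 (wr1 _) rcoset1. Qed.

Lemma same_Inn_coset x y : y \in Aut T -> Inn T :* x = Inn T :* y ->
  exists2 u, u \in T & y^-1 * x = inn u.
Proof.
move=> Ay /rcoset_eqP/rcosetP[_ /InnP[u Tu ->] ->].
by exists (y u); rewrite ?Aut_closed // -conj_autJ.
Qed.

(** An element (x, y).p of G is (x, x).p (1, x^-1 y) if p is even and
    (y, y).p (1, y^-1 x) if p is odd; the second factor lies in T^2 because x
    and y are in the same coset of Inn(T), hence the first one is in G too. *)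
Lemma Omega_points : Omega T G = point @: T.
Proof.
apply/setP=> X; apply/rcosetsP/imsetP => [[g Gg ->]|[t Tt ->]]; last first.
  by exists (wr (1, inn t^-1) 1); rewrite // T2_in_G1 ?groupV.
have coset_point d p u : d \in Aut T -> u \in T ->
    g = wr (d, d) p * wr (1, inn u) 1 -> exists2 t, t \in T & D :* g = point t.
  move=> Ad Tu def_g; exists u^-1; rewrite ?groupV //.
  rewrite /point invgK def_g rcosetM.
  rewrite rcoset_id // mem_D Ad /=.
  by move: Gg; rewrite def_g groupMr // T2_in_G1.
have /imset2P[[x y] p] := subsetP sGD2 g Gg.
rewrite inE /= => /and3P[Ax Ay /eqP eqxy] _ def_g.
case odd_p: (odd_perm p).
  have [u Tu def_u] := same_Inn_coset Ay eqxy.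
  apply: (coset_point y p u) => //.
  rewrite def_g wrM /swap_act odd_p mulg1; congr wr; congr pair.
    by rewrite /= -def_u mulKVg.
  by rewrite /= mulg1.
have [u Tu def_u] := same_Inn_coset Ax (esym eqxy).
apply: (coset_point x p u) => //.
rewrite def_g wrM /swap_act odd_p mulg1; congr wr; congr pair.
  by rewrite /= mulg1.
by rewrite /= -def_u mulKVg.
Qed.

(** * The orbital graphs as Cayley graphs *)

Definition point_orbital s t := orbital G 'Rs%act (point s) (point t).

Lemma orbitalM (a b : {set wreath2 {perm gT}}) s t g : g \in G ->
  ((a :* g, b :* g) \in point_orbital s t) = ((a, b) \in point_orbital s t).
Proof.
move=> Gg; apply/imsetP/imsetP=> [[h Gh]|[h Gh]] /=;
  rewrite !rcosetE => -[def_a def_b].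
  exists (h * g^-1); first by rewrite groupM ?groupV.
  by rewrite /= !rcosetE !rcosetM -def_a -def_b -!rcosetM mulgV !rcoset1.
by exists (h * g); rewrite ?groupM //= !rcosetE !rcosetM def_a def_b.
Qed.

Lemma point_orbitalM s t r a b : r \in T -> a \in T -> b \in T ->
  ((point (r * a), point (r * b)) \in point_orbital s t) =
  ((point a, point b) \in point_orbital s t).
Proof.
move=> Tr Ta Tb.
by rewrite -(invgK r) -!point_translate ?groupV // orbitalM // T2_in_G1 ?groupV.
Qed.

Lemma point_orbital_translate s t r : r \in T -> s \in T -> t \in T ->
  point_orbital (r * s) (r * t) = point_orbital s t.
Proof.
move=> Tr Ts Tt; rewrite /point_orbital; apply/setP=> -[a b].
rewrite -(invgK r) -!point_translate ?groupV //.
have Gr : wr (1, inn r^-1) 1 \in G by rewrite T2_in_G1 ?groupV.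
apply/imsetP/imsetP=> [[g Gg]|[g Gg]] /=; rewrite !rcosetE => -[-> ->].
  exists (wr (1, inn r^-1) 1 * g); first exact: groupM.
  by rewrite /= !rcosetE !rcosetM.
exists ((wr (1, inn r^-1) 1)^-1 * g); first by rewrite groupM ?groupV.
by rewrite /= !rcosetE -!rcosetM mulKVg.
Qed.

(** An element of G mapping the pair (1, t) to the pair (1, u) fixes the point
    1, hence lies in [D], and [point_diag] says what it does to t. *)
Lemma suborbitP t u : t \in T ->
  reflect (exists a p, wr (a, a) p \in D /\
             point u = point (if odd_perm p then (a t)^-1 else a t))
    ((point 1, point u) \in point_orbital 1 t).
Proof.
move=> Tt; apply: (iffP imsetP) => [[g Gg]|[a [p [Dap ->]]]].
  rewrite /= !rcosetE point1 => -[/esym Dg ->].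
  have {}Dg : g \in D by rewrite -Dg rcoset_refl.
  have [a Aa [p def_g]] := DP Dg; rewrite def_g in Dg *.
  by exists a, p; split=> //; rewrite point_diag.
exists (wr (a, a) p); first by case/setIP: Dap.
by rewrite /= !rcosetE point1 rcoset_id // point_diag.
Qed.

(** Both orientations of an edge are translated to start at 1. Since the signs
    allowed in the connection set make it symmetric, reversing the edge, which
    inverts its label, stays within it. *)
Lemma orbital_graph_point t : t \in T ->
  {in T &, forall a b, orbital_graph (point_orbital 1 t) (point a) (point b) =
                       (a^-1 * b \in signed_images diag_proj t)}.
Proof.
move=> Tt a b Ta Tb; rewrite /orbital_graph.
set u := a^-1 * b; have Tu : u \in T by rewrite groupM ?groupV.
have -> : ((point a, point b) \in point_orbital 1 t) =
          ((point 1, point u) \in point_orbital 1 t).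
  by rewrite -(@point_orbitalM 1 t a 1 u) // mulg1 mulKVg.
have -> : ((point b, point a) \in point_orbital 1 t) =
          ((point 1, point u^-1) \in point_orbital 1 t).
  rewrite -(@point_orbitalM 1 t b 1 u^-1) ?groupV // mulg1.
  by rewrite invMg invgK mulKVg.
have Tat x p : wr (x, x) p \in D -> x t \in T.
  by rewrite mem_D => /andP[Ax _]; rewrite Aut_closed.
apply/orP/setUP.
  have wordP v : v \in T -> (point 1, point v) \in point_orbital 1 t ->
      v \in signed_images diag_proj t.
    move=> Tv /(suborbitP _ Tt)[x [p [Dxp]]].
    have Ax : x \in diag_proj by apply/diag_projP; exists p.
    have Txt := Tat _ _ Dxp.
    case: odd_perm => eqv; rewrite (point_inj _ _ eqv) ?groupV //.
      by apply/setUP; right; apply/imsetP; exists x.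
    by apply/setUP; left; apply/imsetP; exists x.
  case=> [/(wordP _ Tu)/setUP //|/(wordP _ (groupVr Tu))].
  by rewrite signed_imagesV => /setUP.
case=> /imsetP[x /diag_projP[p Dxp] ->]; case odd_p: (odd_perm p);
  rewrite ?invgK; [right|left|left|right].
all: by apply/suborbitP=> //; exists x, p; rewrite odd_p.
Qed.

Lemma signed_images_sub t : t \in T ->
  signed_images diag_proj t \subset T.
Proof.
move=> Tt; apply/subsetP=> _ /setUP[]/imsetP[a + ->];
  by rewrite inE => /andP[Aa _]; rewrite ?groupV Aut_closed.
Qed.

Lemma diam_point_orbital t : t \in T ->
  diam (Omega T G) (orbital_graph (point_orbital 1 t))
    = width T (signed_images diag_proj t).
Proof.
move=> Tt; rewrite Omega_points.
apply: diam_cayley (signed_images_sub Tt) point_inj _ _; last first.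
  exact: orbital_graph_point.
have pointG s g : s \in T -> g \in G -> point s :* g \in point @: T.
  move=> Ts Gg; rewrite -Omega_points /point -rcosetM.
  apply/rcosetsP; exists (wr (1, inn s^-1) 1 * g) => //.
  by rewrite groupM // T2_in_G1 ?groupV.
move=> a b /orP[] /imsetP[g Gg] /=; rewrite !rcosetE; case=> def_a def_b.
  by rewrite def_b pointG.
by rewrite def_a pointG.
Qed.

(** Each nondiagonal orbital has a representative (1, t) with t <> 1, found by
    translating its first point to 1. *)
Lemma orbdiam_diagonal :
  orbdiam G (Omega T G) 'Rs
    = \big[maxe/0%E]_(t in T^#) width T (signed_images diag_proj t).
Proof.
apply: le_anti; apply/andP; split; apply: bigmax_le (bigmaxe_ge0 _ _) _.
  move=> Gamma /imset2P[a b + + ->]; rewrite !inE Omega_points.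
  case/imsetP=> s Ts -> /andP[/imsetP[t Tt ->] neq_st].
  rewrite -/(point_orbital s t) -[X in point_orbital X](mulg1 s) -[t](mulKVg s).
  rewrite point_orbital_translate ?groupM ?groupV //.
  rewrite -Omega_points diam_point_orbital ?groupM ?groupV //.
  apply: (le_bigmax_cond _ (fun u => width T (signed_images diag_proj u))).
  rewrite !inE groupM ?groupV // andbT.
  by rewrite -eq_mulVg1; apply: contraNneq neq_st => ->.
move=> t /setD1P[nt_t Tt]; rewrite -diam_point_orbital //.
apply: (le_bigmax_cond _ (fun Gamma => diam _ (orbital_graph Gamma))).
apply/imset2P; exists (point 1) (point t) => //; rewrite ?inE Omega_points.
  by rewrite imset_f.
rewrite imset_f //=; apply: contraNneq nt_t => /point_inj <- //.
Qed.

End DiagonalAction.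

(** * The two extreme groups *)

Lemma diag_proj_T2 (gT : finGroupType) (T : {group gT})
    (G : {group wreath2 {perm gT}}) : G :=: T2 T -> diag_proj T G = Inn T.
Proof.
move=> defG; apply/setP=> a; apply/idP/idP.
  rewrite inE => /andP[_ /existsP[p]]; rewrite defG.
  case/T2P=> u Iu /wr_inj[def_u _].
  by move: Iu; rewrite -def_u inE => /andP[].
move=> Ia; rewrite inE; apply/andP; split; last first.
  by apply/existsP; exists 1; rewrite defG mem_T2.
by case/InnP: Ia => t Tt ->; rewrite Aut_aut.
Qed.

Lemma diag_proj_D2 (gT : finGroupType) (T : {group gT})
    (G : {group wreath2 {perm gT}}) : G :=: D2 T -> diag_proj T G = Aut T.
Proof.
move=> defG; apply/setP=> a; rewrite inE andb_idr // => Aa.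
apply/existsP; exists 1; rewrite defG.
by apply/imset2P; exists (a, a) 1; rewrite // inE /= Aa eqxx.
Qed.

Lemma signed_images_Inn (gT : finGroupType) (T : {group gT}) t : t \in T ->
  signed_images (Inn T) t = t ^: T :|: t^-1 ^: T.
Proof.
move=> Tt; congr (_ :|: _); apply/setP=> u.
  apply/imsetP/imsetP=> [[_ /InnP[x Tx ->] ->]|[x Tx ->]].
    by exists x; rewrite ?conj_autE.
  by exists (conj_aut T x); rewrite ?mem_Inn ?conj_autE.
apply/imsetP/imsetP=> [[_ /InnP[x Tx ->] ->]|[x Tx ->]].
  by exists x; rewrite ?conj_autE ?conjVg.
by exists (conj_aut T x); rewrite ?mem_Inn ?conj_autE ?conjVg.
Qed.

Theorem lemma3p3 (gT : finGroupType) (T : {group gT})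
    (simpleT : simple T) (nonabelianT : ~~ abelian T)
    (G : {group wreath2 {perm gT}})
    (sT2G : T2 T \subset G) (sGD2 : G \subset D2 T)
    (primG : [primitive G, on Omega T G | 'Rs]) :
  (G :=: T2 T -> orbdiam G (Omega T G) 'Rs = c_i T) /\
  (G :=: D2 T -> orbdiam G (Omega T G) 'Rs = c_A T).
Proof.
have ZT := center_simple_nonabelian simpleT nonabelianT.
rewrite orbdiam_diagonal //; split=> defG; last by rewrite (diag_proj_D2 defG).
rewrite (diag_proj_T2 defG); apply: eq_bigr => t /setD1P[_ Tt].
by rewrite signed_images_Inn.
Qed.
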